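(* For all positive integers $k, r$, we have \[ \rho(r, 2r + k) \geq \frac{ \left( \frac{8}{27}k + 1 \right)^{1/3} - 1}{2r+k}. \]
   Context: Let $S^{r-1}$ denote the unit sphere in $\mathbb{R}^r$. For positive integers $r,n$, define \[ \rho(r, n) = \min_{v_1, \ldots, v_{n} \in S^{r-1}} \max_{i \neq j} \langle v_i, v_j \rangle, \] i.e. the smallest possible value of the maximum pairwise inner product among $n$ unit vectors in $\mathbb{R}^r$ (the vectors are indexed by $1,\dots,n$ and the maximum is over pairs of distinct indices). *)

(* Defs.v *)
From mathcomp Require Import all_boot all_order all_algebra.
From mathcomp Require Import all_classical all_reals all_analysis.

Set Implicit Arguments.
Unset Strict Implicit.
Unset Printing Implicit Defensive.

Import Order.TTheory GRing.Theory Num.Theory numFieldNormedType.Exports.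
Local Open Scope classical_set_scope.
Local Open Scope ring_scope.

Definition dot (R : realType) (r : nat) (u v : 'rV[R]_r) : R :=
  \sum_(l < r) u 0 l * v 0 l.

(* The library norm on 'rV[R]_r is the sup norm, hence the use of [dot]. *)
Definition unit_sphere (R : realType) (r : nat) : set 'rV[R]_r :=
  [set u | dot u u = 1].

(* A maximum as soon as 1 < n, by [max_dot_attained]. *)
Definition max_dot (R : realType) (r n : nat) (v : 'I_n -> 'rV[R]_r) : R :=
  sup [set dot (v p.1) (v p.2) | p in [set p : 'I_n * 'I_n | p.1 != p.2]].

(* A minimum as soon as 0 < r and 1 < n, by [rho_attained]. *)
Definition rho (R : realType) (r n : nat) : R :=
  inf [set max_dot v |
       v in [set v : 'I_n -> 'rV[R]_r | forall i, unit_sphere (v i)]].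

Lemma max_dot_attained (R : realType) (r n : nat) (v : 'I_n -> 'rV[R]_r) :
  (1 < n)%N ->
  (exists i j, i != j /\ max_dot v = dot (v i) (v j)) /\
  (forall i j, i != j -> dot (v i) (v j) <= max_dot v).
Proof.
move=> n1; pose p0 := (Ordinal (ltnW n1), Ordinal n1).
have [p pN maxp] := @arg_maxP _ R _ p0 (fun p => p.1 != p.2)
  (fun p => dot (v p.1) (v p.2)) isT.
suff maxE : max_dot v = dot (v p.1) (v p.2).
  by split=> [|i j ij]; [exists p.1, p.2 | rewrite maxE; exact: (maxp (i, j))].
apply/eqP; rewrite eq_le; apply/andP; split.
  apply: ge_sup => [|_ [q qN <-]]; last exact: maxp.
  by exists (dot (v p.1) (v p.2)), p.
apply: ub_le_sup; last by exists p.
by exists (dot (v p.1) (v p.2)) => _ [q qN <-]; exact: maxp.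
Qed.

Lemma continuous_dot_row (R : realType) (r n : nat) (i j : 'I_n) :
  continuous (fun w : 'rV[R]_(n * r) =>
    dot (row i (vec_mx w)) (row j (vec_mx w)) : R^o).
Proof.
move=> w.
have -> : (fun w : 'rV[R]_(n * r) =>
      dot (row i (vec_mx w)) (row j (vec_mx w)) : R^o) =
    \sum_(l < r) (fun w : 'rV[R]_(n * r) =>
      w 0 (mxvec_index i l) * w 0 (mxvec_index j l) : R^o).
  by apply/funext => x; rewrite fct_sumE; apply: eq_bigr => l _; rewrite !mxE.
apply: (big_ind (fun f : 'rV[R]_(n * r) -> R^o => {for w, continuous f})).
- exact: (@cst_continuous _ _ (0 : R^o) w).
- by move=> f g cf cg; exact: (@continuousD _ _ _ f g w cf cg).
- by move=> l _; apply: (@continuousM _ _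
    (fun w : 'rV[R]_(n * r) => w 0 (mxvec_index i l) : R^o)
    (fun w => w 0 (mxvec_index j l) : R^o)); exact: coord_continuous.
Qed.

Lemma continuous_max_dot (R : realType) (r n : nat) : (1 < n)%N ->
  continuous (fun w : 'rV[R]_(n * r) =>
    max_dot (fun i => row i (vec_mx w)) : R^o).
Proof.
move=> n1; pose p0 := (Ordinal (ltnW n1), Ordinal n1).
pose d (p : 'I_n * 'I_n) (w : 'rV[R]_(n * r)) : R^o :=
  dot (row p.1 (vec_mx w)) (row p.2 (vec_mx w)).
have maxE w : max_dot (fun i => row i (vec_mx w)) =
    (\big[Num.max/d p0 w]_(p : 'I_n * 'I_n | p.1 != p.2) d p w).
  have [[i [j [ij mE]]] mge] := max_dot_attained (fun i => row i (vec_mx w)) n1.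
  apply/eqP; rewrite eq_le; apply/andP; split.
    by rewrite mE; exact: (le_bigmax_cond _ (fun p => d p w) (j := (i, j))).
  by apply/bigmax_leP; split=> [|p pN]; exact: mge.
pose g s w : R^o := \big[Num.max/d p0 w]_(p <- s | p.1 != p.2) d p w.
suff cg s : continuous (g s).
  rewrite (_ : (fun w => _) = g (index_enum _)); first exact: cg.
  exact/funext/maxE.
elim: s => [|p s IHs] w.
  rewrite (_ : g _ = d p0); first exact: continuous_dot_row.
  by apply/funext => x; rewrite /g big_nil.
rewrite (_ : g _ = if p.1 != p.2 then d p \max g s else g s).
  case: ifPn => _; last exact: IHs.
  apply: continuous_max; last exact: IHs.
  exact: continuous_dot_row.
by case: ifPn => pN; apply/funext => x; rewrite /g big_cons ?pN ?(negbTE pN).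
Qed.

Lemma rho_attained (R : realType) (r n : nat) : (0 < r)%N -> (1 < n)%N ->
  (exists v : 'I_n -> 'rV[R]_r,
    (forall i, unit_sphere (v i)) /\ rho R r n = max_dot v) /\
  (forall v : 'I_n -> 'rV[R]_r,
    (forall i, unit_sphere (v i)) -> rho R r n <= max_dot v).
Proof.
move=> r0 n1.
pose rows (w : 'rV[R]_(n * r)) i := row i (vec_mx w).
pose A := [set w | forall i, unit_sphere (rows w i)].
have rowsE v : rows (mxvec (\matrix_i v i)) = v.
  by apply/funext => i; rewrite /rows mxvecK rowK.
have A0 : A !=set0.
  exists (mxvec (\matrix_i (delta_mx 0 (Ordinal r0)))) => i.
  rewrite /unit_sphere /= rowsE /dot (bigD1 (Ordinal r0))//= big1 => [|l lN].
    by rewrite !mxE !eqxx mulr1 addr0.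
  by rewrite !mxE (negbTE lN) andbF mul0r.
have cA : compact A.
  have clA : closed A.
    have -> : A = \bigcap_(i in [set: 'I_n])
        [set w | dot (rows w i) (rows w i) = 1].
      by apply/seteqP; split=> [w Aw i _|w Aw i]; exact: Aw.
    apply: closed_bigI => i _.
    apply: (preimage_closed (f := fun w => dot (rows w i) (rows w i) : R^o)
      (D := [set x | x = 1])); last exact: closed_eq.
    by move=> w _; exact: continuous_dot_row.
  have boxC : compact
      [set w : 'rV[R]_(n * r) | forall j, (w ord0 j : R) \in `[-1, 1]].
    apply: (@rV_compact _ _ (fun=> `[(-1 : R), 1]%classic)) => _.
    exact: segment_compact.
  apply: subclosed_compact clA boxC _.
  move=> w Aw j /=; case/mxvec_indexP: j => i l; rewrite in_itv /= -ler_norml.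
  rewrite -(@expr_le1 _ 2)// real_normK ?num_real// -(Aw i) /dot (bigD1 l)//=.
  rewrite !mxE -expr2 lerDl; apply: sumr_ge0 => m _.
  by rewrite -expr2 sqr_ge0.
have [c cA' minc] := EVT_min_rV A0 cA
  (continuous_subspaceT (@continuous_max_dot R r n n1)).
have {}cA' : A c by exact: set_mem.
have {}minc (v : 'I_n -> 'rV[R]_r) : (forall i, unit_sphere (v i)) ->
    max_dot (rows c) <= max_dot v.
  by move=> Sv; rewrite -(rowsE v); apply: minc; apply/mem_set => i; rewrite rowsE.
suff rhoE : rho R r n = max_dot (rows c).
  by split=> [|v Sv]; [exists (rows c) | rewrite rhoE; exact: minc].
apply/eqP; rewrite eq_le; apply/andP; split.
  apply: ge_inf; last by exists (rows c).
  by exists (max_dot (rows c)) => _ [v Sv <-]; exact: minc.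
apply: lb_le_inf => [|_ [v Sv <-]]; last exact: minc.
by exists (max_dot (rows c)), (rows c).
Qed.

(* Main.v *)
Require Import Defs.
From mathcomp Require Import all_boot all_order all_algebra.
From mathcomp Require Import all_classical all_reals all_analysis.
From mathcomp Require Import ring lra.
Import Order.TTheory GRing.Theory Num.Theory numFieldNormedType.Exports.
Local Open Scope ring_scope.

(* Let [M] be the Gram matrix of [n = 2r + k] unit vectors with pairwise inner
   products at most [a], [J] the all-ones matrix and [s = 1 - a]. The matrix
   [A = s I + a J - M] has zero diagonal and nonnegative entries, so
   [tr A ^ 3 >= 0]. On the other hand [M] has rank at most [r], hence [s] is an
   eigenvalue of [A] of multiplicity at least [r + k - 1], no other eigenvalue
   except the largest one exceeds [s], and applying
   [x ^ 3 - 3 s ^ 2 x - 2 s ^ 3 = (x + s) ^ 2 (x - 2 s) <= 0] to all of them but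
   the largest bounds [tr A ^ 3] from above. Below, this spectral estimate is
   replaced by three sums of squares: with [V] the matrix whose rows are the
   vectors, [M = V V^T] and [C = M - 2 s I - (3/2) a J], the traces
   [|V^T V - 2 s I| ^ 2], [|C V| ^ 2] and [|J V| ^ 2] are nonnegative, which
   gives [2 s ^ 3 k <= 3 s q ^ 2 + q ^ 3] for [q = a n]. *)

Set Implicit Arguments.
Unset Strict Implicit.
Unset Printing Implicit Defensive.

Lemma mxtrace_mulC3 (R : comPzRingType) (n : nat) (X Y Z : 'M[R]_n) :
  \tr (X *m Y *m Z) = \tr (Z *m X *m Y).
Proof. by rewrite mxtrace_mulC mulmxA. Qed.

(** Cyclic invariance of the trace replaces commutativity here: each mixed product is a rotation of
    [X X Y] or [X Y Y]. *)
Lemma mxtrace_cubeD (R : comNzRingType) (n : nat) (X Y : 'M[R]_n) :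
  \tr ((X + Y) *m (X + Y) *m (X + Y)) =
  \tr (X *m X *m X) + 3%:R * \tr (X *m X *m Y) +
  3%:R * \tr (X *m Y *m Y) + \tr (Y *m Y *m Y).
Proof.
rewrite !(mulmxDl, mulmxDr) !mxtraceD.
rewrite (mxtrace_mulC3 Y X X) (mxtrace_mulC3 X Y X).
rewrite (mxtrace_mulC3 Y X Y) (mxtrace_mulC3 Y Y X).
ring.
Qed.

Lemma mxtrace_tr_mul_ge0 (R : realDomainType) (m n : nat) (X : 'M[R]_(m, n)) :
  0 <= \tr (X^T *m X).
Proof.
apply: sumr_ge0 => i _; rewrite mxE; apply: sumr_ge0 => j _.
by rewrite mxE -expr2 sqr_ge0.
Qed.

Lemma mxtrace_sqr_gram_ge0 (R : realDomainType) (n r : nat) (V : 'M[R]_(n, r))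
  (C : 'M[R]_n) : C^T = C -> 0 <= \tr (C *m C *m (V *m V^T)).
Proof.
move=> CT; have := mxtrace_tr_mul_ge0 (C *m V).
by rewrite trmx_mul CT mxtrace_mulC !mulmxA mxtrace_mulC !mulmxA.
Qed.

Lemma mxtrace_cube_ge0 (R : realDomainType) (n : nat) (A : 'M[R]_n) :
  (forall i j, 0 <= A i j) -> 0 <= \tr (A *m A *m A).
Proof.
move=> A0; apply: sumr_ge0 => i _; rewrite mxE; apply: sumr_ge0 => j _.
by rewrite mulr_ge0// mxE; apply: sumr_ge0 => l _; exact: mulr_ge0.
Qed.

(** Expands [|V^T V - x I| ^ 2 >= 0]. The matrix [V^T V] has size [r], which is how the rank bound
    enters. *)
Lemma mxtrace_gram_sqr_ge (R : realDomainType) (n r : nat) (V : 'M[R]_(n, r))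
  (x : R) : 2%:R * x * \tr (V *m V^T) - x ^+ 2 * r%:R <=
  \tr (V *m V^T *m (V *m V^T)).
Proof.
have := mxtrace_tr_mul_ge0 (V^T *m V - x%:M).
rewrite [(_ - _)^T]linearB /= trmx_mul trmxK tr_scalar_mx mulmxBl !mulmxBr.
rewrite !mul_scalar_mx !mul_mx_scalar !raddfB /= !mxtraceZ mxtrace_scalar.
have -> : \tr (V^T *m V *m (V^T *m V)) = \tr (V *m V^T *m (V *m V^T)).
  by rewrite -mulmxA mxtrace_mulC !mulmxA.
rewrite (mxtrace_mulC V^T V) -mulr_natr; lra.
Qed.

(** For [M = V V^T] this is [|C V| ^ 2], written in the same traces as [mxtrace_shift_cube] so that
    [tr M ^ 3] cancels in the sum of the two. *)
Lemma mxtrace_shift_sqr_mul (R : realFieldType) (n : nat) (M J : 'M[R]_n)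
  (x b c : R) : J *m J = c *: J ->
  let C := M - x%:M - b *: J in
  \tr (C *m C *m M) = \tr (M *m M *m M) - 2%:R * x * \tr (M *m M)
    + x ^+ 2 * \tr M - 2%:R * b * \tr (M *m M *m J)
    + (2%:R * b * x + b ^+ 2 * c) * \tr (M *m J).
Proof.
move=> JJ /=.
rewrite !(mulmxBl, mulmxBr) !(mul_scalar_mx, mul_mx_scalar).
rewrite -!(scalemxAl, scalemxAr) JJ !raddfB /= !mxtraceZ.
rewrite ?mul_scalar_mx -!(scalemxAl, scalemxAr) !mxtraceZ.
rewrite (mxtrace_mulC3 J M M) (mxtrace_mulC3 M J M).
rewrite (mxtrace_mulC J M).
ring.
Qed.

Lemma mxtrace_shift_cube (R : realFieldType) (n : nat) (M J : 'M[R]_n)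
  (s a c : R) : J *m J = c *: J ->
  let A := s%:M + (a *: J - M) in
  \tr (A *m A *m A) = s ^+ 3 * n%:R + 3%:R * s ^+ 2 * (a * \tr J - \tr M)
    + 3%:R * s * (a ^+ 2 * c * \tr J - 2%:R * a * \tr (M *m J) + \tr (M *m M))
    + a ^+ 3 * c ^+ 2 * \tr J - 3%:R * a ^+ 2 * c * \tr (M *m J)
    + 3%:R * a * \tr (M *m M *m J) - \tr (M *m M *m M).
Proof.
move=> JJ /=.
rewrite mxtrace_cubeD mxtrace_cubeD.
rewrite !(mul_scalar_mx, mul_mx_scalar).
rewrite !(mulmxBl, mulmxBr, mulmxN, mulNmx).
rewrite -!(scalemxAl, scalemxAr) !JJ -!(scalemxAl, scalemxAr) !JJ.
rewrite !mul_scalar_mx !mulmxBl -!(scalemxAl, scalemxAr) !JJ !opprK.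
have trN (X : 'M[R]_n) : \tr (- X) = - \tr X by exact: raddfN.
rewrite !(mxtraceZ, mxtraceD, trN) mxtrace_scalar.
rewrite (mxtrace_mulC3 J M M) (mxtrace_mulC3 M J M).
rewrite (mxtrace_mulC J M).
ring.
Qed.

(** The right side minus [tr A ^ 3] is exactly [|C V| ^ 2 + s |V^T V - 2 s I| ^ 2 + (3/4) a ^ 2 |J
    V| ^ 2]. *)
Lemma mxtrace_cube_gram_le (R : realFieldType) (n r : nat) (V : 'M[R]_(n, r))
  (a s : R) : 0 <= s -> \tr (V *m V^T) = n%:R ->
  let A := s%:M + (a *: const_mx 1 - V *m V^T) in
  \tr (A *m A *m A) <= s ^+ 3 * (n%:R + 4%:R * r%:R) - 3%:R * s ^+ 2 * n%:R
    + 3%:R * s ^+ 2 * (a * n%:R) + 3%:R * s * (a * n%:R) ^+ 2 + (a * n%:R) ^+ 3.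
Proof.
move=> s0 trM /=.
have := mxtrace_gram_sqr_ge V (2%:R * s).
set J : 'M[R]_n := const_mx 1.
have JJ : J *m J = n%:R *: J.
  apply/matrixP => i j; rewrite !mxE.
  under eq_bigr do rewrite !mxE mulr1.
  by rewrite sumr_const card_ord mulr1.
have trJ : \tr J = n%:R.
  rewrite /mxtrace; under eq_bigr do rewrite mxE.
  by rewrite sumr_const card_ord.
have JT : J^T = J by rewrite trmx_const.
(* The coefficient [3 a / 2] cancels [tr (M M J)] against [tr A ^ 3]; then [2 s] cancels the
   multiples of [s a tr (M J)]. *)
have /(mxtrace_sqr_gram_ge0 V) : (V *m V^T - (2%:R * s)%:M
    - (3%:R / 2%:R * a) *: J)^T = V *m V^T - (2%:R * s)%:M
    - (3%:R / 2%:R * a) *: J.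
  rewrite !raddfB /= tr_scalar_mx (trmx_mul V) trmxK.
  by congr (_ - _); apply/matrixP => i j; rewrite !mxE.
have := mxtrace_sqr_gram_ge0 V JT.
move: (V *m V^T) trM => M trM.
rewrite (mxtrace_shift_sqr_mul _ _ _ JJ) (mxtrace_shift_cube _ _ _ JJ) JJ trM trJ.
rewrite -scalemxAl mxtraceZ (mxtrace_mulC J M).
move: (\tr (M *m J)) (\tr (M *m M)) (\tr (M *m M *m J)) (\tr (M *m M *m M)).
move=> x y z t nx Ct /(ler_wpM2l s0) y0.
have := mulr_ge0 (sqr_ge0 a) nx.
lra.
Qed.

Lemma gram_offdiag_bound (R : realFieldType) (k r : nat)
  (V : 'M[R]_(2 * r + k, r)) (a : R) :
  (forall i, (V *m V^T) i i = 1) ->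
  (forall i j, i != j -> (V *m V^T) i j <= a) -> a <= 1 ->
  let q := a * (2 * r + k)%:R in
  2%:R * (1 - a) ^+ 3 * k%:R <= 3%:R * (1 - a) * q ^+ 2 + q ^+ 3.
Proof.
move=> V1 Va a1 /=; set q := a * _.
have trV : \tr (V *m V^T) = (2 * r + k)%:R.
  by rewrite /mxtrace (eq_bigr _ (fun i _ => V1 i)) sumr_const card_ord.
have s0 : 0 <= 1 - a by rewrite subr_ge0.
have := mxtrace_cube_gram_le a s0 trV.
set A := _ + _ => leA.
have A0 i j : 0 <= A i j.
  rewrite /A; move: (V *m V^T) V1 Va => M V1 Va; rewrite !mxE.
  have [->|ij] := eqVneq i j; first by rewrite V1 mulr1n; lra.
  by rewrite mulr0n; have := Va i j ij; lra.
have := le_trans (mxtrace_cube_ge0 A0) leA.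
rewrite -/q.
(* With [1 = s + a] split off, the terms in [s ^ 2 q] cancel and
   [s ^ 3 (n + 4 r - 3 n) = - 2 k s ^ 3] remains. *)
have -> : 3%:R * (1 - a) ^+ 2 * (2 * r + k)%:R =
  3%:R * (1 - a) ^+ 3 * (2 * r + k)%:R + 3%:R * (1 - a) ^+ 2 * q.
  by rewrite /q; ring.
have -> : (2 * r + k)%:R = 2%:R * r%:R + k%:R :> R by rewrite natrD natrM.
move: q ((1 - a) ^+ 2) ((1 - a) ^+ 3) => q u w; lra.
Qed.

Lemma max_offdiag_gram_bound (R : realFieldType) (k r : nat)
  (V : 'M[R]_(2 * r + k, r)) (a : R) : (0 < k)%N ->
  (forall i, (V *m V^T) i i = 1) ->
  (forall i j, i != j -> (V *m V^T) i j <= a) ->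
  0 <= a /\ 8%:R / 27%:R * k%:R + 1 <= (1 + a * (2 * r + k)%:R) ^+ 3.
Proof.
move=> k0 V1 Va.
have k1 : 1 <= k%:R :> R by rewrite ler1n.
have kn : k%:R <= (2 * r + k)%:R :> R by rewrite ler_nat leq_addl.
(* If [a < 0], the bound at [0] in place of [a] reads [2 k <= 0]: at most [2 r] unit vectors have
   pairwise nonpositive products. *)
have [a0|a0] := ltP a 0.
  have Va0 i j : i != j -> (V *m V^T) i j <= 0.
    by move=> /Va /le_trans; apply; exact: ltW.
  have := gram_offdiag_bound V1 Va0 ler01.
  by rewrite /= subr0 mul0r expr1n !expr0n /=; lra.
split=> //.
(* Above [1/3] the term [3 q >= k] of the cube suffices; this includes [a > 1], outside the scope of
   [gram_offdiag_bound]. *)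
have [a3|a3] := leP a (1 / 3%:R); last first.
  have := mulr_ge0 a0 (le_trans (le_trans ler01 k1) kn).
  have : 1 / 3%:R * k%:R <= a * (2 * r + k)%:R.
    by apply: ler_pM => //; lra.
  move: (a * _) => q kq q0; have q2 := sqr_ge0 q; have q3 := exprn_ge0 3 q0.
  have -> : (1 + q) ^+ 3 = 1 + 3%:R * q + 3%:R * q ^+ 2 + q ^+ 3 by ring.
  lra.
have a1 : a <= 1 by lra.
have := gram_offdiag_bound V1 Va a1.
have := mulr_ge0 a0 (le_trans (le_trans ler01 k1) kn).
move: (a * _) => q q0 /=.
(* The constant [8/27] is [(1 - a) ^ 3] at the threshold [a = 1/3]. *)
have s3 : 8%:R / 27%:R * k%:R <= (1 - a) ^+ 3 * k%:R.
  rewrite ler_wpM2r ?ler0n//.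
  have -> : 8%:R / 27%:R = (2%:R / 3%:R) ^+ 3 :> R by field.
  by rewrite lerXn2r ?nnegrE; lra.
have q2 := sqr_ge0 q; have q3 := exprn_ge0 3 q0.
have sq : (1 - a) * q ^+ 2 <= q ^+ 2 by rewrite ler_piMl//; lra.
have -> : (1 + q) ^+ 3 = 1 + 3%:R * q + 3%:R * q ^+ 2 + q ^+ 3 by ring.
rewrite -!mulrA; lra.
Qed.

Theorem theorem1p1 (R : realType) (k r : nat) (hk : (0 < k)%N) (hr : (0 < r)%N) :
  rho R r (2 * r + k) >=
    ((8%:R / 27%:R * k%:R + 1) `^ (3%:R^-1) - 1) / (2 * r + k)%:R.
Proof.
have n1 : (1 < 2 * r + k)%N.
  by rewrite mul2n -addnn -addnA (leq_add hr)// ltn_addl.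
have n0 : 0 < (2 * r + k)%:R :> R by rewrite ltr0n ltnW.
have [[v [v1 ->]] _] := rho_attained R hr n1.
have [_ vle] := max_dot_attained v n1.
pose V := \matrix_i v i.
have gramE i j : (V *m V^T) i j = dot (v i) (v j).
  by rewrite mxE; apply: eq_bigr => l _; rewrite !mxE.
have V1 i : (V *m V^T) i i = 1 by rewrite gramE; exact: v1.
have Vle i j : i != j -> (V *m V^T) i j <= max_dot v.
  by rewrite gramE; exact: vle.
have [a0 cube_le] := max_offdiag_gram_bound hk V1 Vle.
rewrite ler_pdivrMr// lerBlDl.
have b0 : 0 <= 1 + max_dot v * (2 * r + k)%:R.
  by rewrite addr_ge0// mulr_ge0// ltW.
have c0 : 0 <= 8%:R / 27%:R * k%:R + 1 :> R.
  by rewrite addr_ge0// mulr_ge0// divr_ge0.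
have := @ge0_ler_powR _ (3%:R^-1 : R) _ _ _ _ _ cube_le.
rewrite -(powR_mulrn 3 b0) -powRrM divff// powRr1//.
by apply; rewrite ?nnegrE// ?powR_ge0// exprn_ge0.
Qed.
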